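(* Let $U$ be either $G(6,2) = \{(i,i) : 1 \le i \le 6\} \cup \{(i,i+1) : 1 \le i \le 5\} \cup \{(6,1)\}$ or $G'(6,2) = \{(i,i) : 1 \le i \le 6\} \cup \{(i,i+1) : 1 \le i \le 5\}$. Then for every integer $N \geq 6$ the set of typical coranks of $S = ([N]\times[N])\setminus U$ is exactly $\{3\}$. (In the paper's notation: $\mathrm{tc}(G(6,2)^{\mathsf c}) = \mathrm{tc}(G'(6,2)^{\mathsf c}) = \{3\}$.)
   Context: $[N] = \{1,\ldots,N\}$. For $S \subseteq [N]\times[N]$ (the specified entries), a partial filling is a point $A \in \mathbb{R}^S$. A real completion of $A$ is a matrix $M \in \mathbb{R}^{N\times N}$ with $M_{ij} = A_{ij}$ for all $(i,j)\in S$. An integer $r$ is a typical rank of $S$ if there is a nonempty Euclidean open subset of $\mathbb{R}^S$ such that for every $A$ in it, the minimum rank among all real completions of $A$ equals $r$. The typical coranks of $S$ are the numbers $N - r$ with $r$ a typical rank of $S$. For a finite set $U$ of unspecified entries, $\mathrm{tc}(U^{\mathsf c})$ denotes the set of typical coranks of $([N]\times[N])\setminus U$, for any $N$ with $U \subseteq [N]\times[N]$ (this does not depend on $N$). *)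

(* Defs.v *)
From HB Require Import structures.
From mathcomp Require Import all_boot all_order all_algebra.
From mathcomp Require Import all_classical all_reals all_analysis.
Import numFieldNormedType.Exports.

Set Implicit Arguments.
Unset Strict Implicit.
Unset Printing Implicit Defensive.

Local Open Scope classical_set_scope.

(* R^S with the product topology; S is finite, so this is the Euclidean
   topology. *)
Definition partial_filling (R : realType) (N : nat)
    (S : {set 'I_N * 'I_N}) : topologicalType :=
  prod_topology (fun _ : {p : 'I_N * 'I_N | p \in S} => R : topologicalType).

Definition is_completion (R : realType) (N : nat) (S : {set 'I_N * 'I_N})
    (A : partial_filling R S) (M : 'M[R]_N) : Prop :=
  forall p : {p : 'I_N * 'I_N | p \in S}, M (val p).1 (val p).2 = A p.

Definition is_min_completion_rank (R : realType) (N : nat)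
    (S : {set 'I_N * 'I_N}) (A : partial_filling R S) (r : nat) : Prop :=
  (exists2 M : 'M[R]_N, is_completion A M & \rank M = r) /\
  (forall M : 'M[R]_N, is_completion A M -> (r <= \rank M)%N).

Definition typical_rank (R : realType) (N : nat) (S : {set 'I_N * 'I_N})
    (r : nat) : Prop :=
  exists O : set (partial_filling R S),
    [/\ open O, O !=set0 &
        forall A : partial_filling R S, O A -> is_min_completion_rank A r].

(* The truncated subtraction is exact: a typical rank r is the rank of some
   N x N matrix, whence r <= N. *)
Definition typical_coranks (R : realType) (N : nat) (S : {set 'I_N * 'I_N}) :
    set nat :=
  [set (N - r)%N | r in typical_rank R S].

(* Positions of unspecified entries are listed with 1-based indices, whereas
   the elements of 'I_N are 0, ..., N - 1; hence the successors. *)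
Definition complement_pattern (N : nat) (U : seq (nat * nat)) :
    {set 'I_N * 'I_N} :=
  [set p : 'I_N * 'I_N | (p.1.+1, p.2.+1) \notin U]%SET.

Definition Gprime62 : seq (nat * nat) :=
  [seq (i, i) | i <- iota 1 6] ++ [seq (i, i.+1) | i <- iota 1 5].

Definition G62 : seq (nat * nat) := Gprime62 ++ [:: (6, 1)].

(* Main.v *)
(* Corank is computed generically. If the fully specified lower right block [D]
   is invertible, then the corank of a completion is that of the 6 x 6 Schur
   complement, whose specified entries are again generic, so let N = 6.

   Rank 2 is impossible even for G(6,2): five vanishing 3 x 3 minors involve
   only the four unknowns x34, x11, x45, x44; four of the minors determine
   these rationally, and the fifth is then a nontrivial condition on the
   specified entries.

   Rank 3 is attained even for G'(6,2): impose row1 = row3 + mu * row6. This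
   determines mu, x33, x34 and x66; then the known entries of rows 4 and 2 in
   three columns fix the coefficients of these rows on rows 3, 6, 5, and the
   fourth known entry of each fixes x56, respectively x55. So there is a
   completion depending rationally on the specified entries, hence a real one.

   Both conclusions hold wherever certain rational functions are regular and
   nonzero. It is enough to check this at one filling: the zero set of a
   polynomial that is nonzero somewhere is closed with dense complement, since
   along a line the polynomial has finitely many zeros. *)
Require Import Defs.
From mathcomp Require Import all_boot all_order all_algebra.
From mathcomp Require Import all_classical all_reals all_analysis.
From mathcomp Require Import ring.
Import Order.TTheory GRing.Theory Num.Theory numFieldNormedType.Exports.

Set Implicit Arguments.
Unset Strict Implicit.
Unset Printing Implicit Defensive.

Local Open Scope classical_set_scope.
Local Open Scope ring_scope.

(** * Polynomial and regular functions on [R^I], and Zariski neighbourhoods *)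

Section PolyFun.
Variables (R : realType) (I : eqType).
Local Notation X := (prod_topology (fun _ : I => R : topologicalType)).

Definition segment (A B : X) (t : R) : X := fun i => A i + t * (B i - A i).

Lemma segment0 A B : segment A B 0 = A.
Proof. by apply/funext => i; rewrite /segment mul0r addr0. Qed.

Lemma segment1 A B : segment A B 1 = B.
Proof. by apply/funext => i; rewrite /segment mul1r addrC subrK. Qed.

Lemma segment_continuous A B : continuous (segment A B).
Proof.
move=> t; apply/cvg_sup => i U [_ [[C oC <-] Ct]] sCU.
apply: (filterS sCU).
have : continuous (fun s : R => A i + s * (B i - A i)).
  move=> s; apply: cvgD; first exact: cvg_cst.
  by apply: cvgM; [exact: cvg_id | exact: cvg_cst].
by move=> /(_ t C); apply; exact: open_nbhs_nbhs.
Qed.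

(** Two features of polynomials suffice: continuity makes nonvanishing loci open, and restriction to
    lines reduces density to polynomials in one variable. *)
Definition polyfun (f : X -> R) : Prop :=
  continuous f /\
  forall A B, exists p : {poly R}, forall t, f (segment A B t) = p.[t].

Lemma polyfun_cst c : polyfun (fun=> c).
Proof.
split; first exact: cst_continuous.
by move=> A B; exists c%:P => t; rewrite hornerC.
Qed.

Lemma polyfun_coord i : polyfun (fun A => A i).
Proof.
split; first exact: (@proj_continuous I (fun=> R) i).
move=> A B; exists ((A i)%:P + 'X * (B i - A i)%:P) => t.
by rewrite !hornerE.
Qed.

Lemma eq_polyfun g f : f =1 g -> polyfun g -> polyfun f.
Proof. by move=> /funext ->. Qed.

Lemma polyfunD f g : polyfun f -> polyfun g -> polyfun (fun A => f A + g A).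
Proof.
move=> [cf pf] [cg pg]; split.
  by move=> A; exact: (cvgD (cf A) (cg A)).
move=> A B; have [p hp] := pf A B; have [q hq] := pg A B.
by exists (p + q) => t; rewrite hornerD hp hq.
Qed.

Lemma polyfunM f g : polyfun f -> polyfun g -> polyfun (fun A => f A * g A).
Proof.
move=> [cf pf] [cg pg]; split.
  by move=> A; exact: (cvgM (cf A) (cg A)).
move=> A B; have [p hp] := pf A B; have [q hq] := pg A B.
by exists (p * q) => t; rewrite hornerM hp hq.
Qed.

Lemma polyfun_sum (J : Type) (r : seq J) (P : pred J) (f : J -> X -> R) :
  (forall j, polyfun (f j)) -> polyfun (fun A => \sum_(j <- r | P j) f j A).
Proof.
move=> hf; elim: r => [|j r IHr].
  by under eq_fun do rewrite big_nil; exact: polyfun_cst.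
under eq_fun do rewrite big_cons.
by case: (P j) => //; exact: polyfunD.
Qed.

Lemma polyfun_prod (J : Type) (r : seq J) (P : pred J) (f : J -> X -> R) :
  (forall j, polyfun (f j)) -> polyfun (fun A => \prod_(j <- r | P j) f j A).
Proof.
move=> hf; elim: r => [|j r IHr].
  by under eq_fun do rewrite big_nil; exact: polyfun_cst.
under eq_fun do rewrite big_cons.
by case: (P j) => //; exact: polyfunM.
Qed.

Lemma polyfun_det n (F : X -> 'M[R]_n) :
  (forall i j, polyfun (fun A => F A i j)) -> polyfun (fun A => \det (F A)).
Proof.
move=> hF; apply: polyfun_sum => s.
by apply: polyfunM; [exact: polyfun_cst | exact: polyfun_prod].
Qed.

Lemma polyfun_mulmx m n p (F : X -> 'M[R]_(m, n)) (G : X -> 'M[R]_(n, p)) i j :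
  (forall i j, polyfun (fun A => F A i j)) ->
  (forall i j, polyfun (fun A => G A i j)) ->
  polyfun (fun A => (F A *m G A) i j).
Proof.
move=> hF hG; under eq_fun do rewrite mxE.
by apply: polyfun_sum => k; exact: polyfunM.
Qed.

Lemma polyfun_adj n (F : X -> 'M[R]_n) i j :
  (forall i j, polyfun (fun A => F A i j)) ->
  polyfun (fun A => (\adj (F A)) i j).
Proof.
move=> hF; under eq_fun do rewrite mxE.
apply: polyfunM; first exact: polyfun_cst.
apply: polyfun_det => k l.
by under eq_fun do rewrite !mxE; exact: hF.
Qed.

Lemma open_polyfun_neq0 f : polyfun f -> open [set A | f A != 0].
Proof.
move=> [cf _]; apply: (open_comp (f := f) (D := [set x | x != 0])).
  by move=> A _; exact: cf.
exact: open_neq.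
Qed.

Lemma poly_neq0_near (p : {poly R}) (U : set R) (x : R) :
  p != 0 -> nbhs x U -> exists2 t, U t & p.[t] != 0.
Proof.
move=> p0 /nbhs_ballP [e /= e0 eU].
(* Infinitely many distinct points of the ball, too many to be all roots of [p]; [n.+2] rather than
   [n.+1] keeps [r 0] off the boundary. *)
pose r n := x + e / n.+2%:R.
have rU n : U (r n).
  apply: eU; rewrite /ball /= /r opprD addrA subrr sub0r normrN gtr0_norm.
    by rewrite ltr_pdivrMr // ltr_pMr // ltr1n.
  by rewrite divr_gt0.
have r_inj : injective r.
  move=> m n /addrI /(mulfI (lt0r_neq0 e0)) /invr_inj /eqP.
  by rewrite eqr_nat !eqSS => /eqP.
have [|] := boolP (all (root p) [seq r n | n <- iota 0 (size p)]); last first.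
  rewrite -has_predC => /hasP [_ /mapP [n _ ->] hn].
  by exists (r n).
move=> /(max_poly_roots p0); rewrite map_inj_uniq // iota_uniq => /(_ isT).
by rewrite size_map size_iota ltnn.
Qed.

(* [W] contains a Zariski open neighbourhood of [A0]. *)
Definition zariski_near (A0 : X) (W : set X) : Prop :=
  exists f, [/\ polyfun f, f A0 != 0 & forall A, f A != 0 -> W A].

Lemma zariski_nearI A0 W1 W2 :
  zariski_near A0 W1 -> zariski_near A0 W2 -> zariski_near A0 (W1 `&` W2).
Proof.
move=> [f [pf f0 fW]] [g [pg g0 gW]].
exists (fun A => f A * g A); split; [exact: polyfunM | exact: mulf_neq0 |].
by move=> A; rewrite mulf_eq0 negb_or => /andP [/fW ? /gW ?].
Qed.

Lemma zariski_nearS A0 W1 W2 :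
  W1 `<=` W2 -> zariski_near A0 W1 -> zariski_near A0 W2.
Proof. by move=> sW [f [pf f0 fW]]; exists f; split => // A /fW /sW. Qed.

Lemma zariski_near_open A0 W :
  zariski_near A0 W -> exists O : set X, [/\ open O, O !=set0 & O `<=` W].
Proof.
move=> [f [pf f0 fW]]; exists [set A | f A != 0].
by split; [exact: open_polyfun_neq0 | exists A0 | exact: fW].
Qed.

(** On the line from a point of [O] to [A0], [f] is a polynomial that is nonzero at the end [A0],
    hence nonzero at points arbitrarily close to the start. *)
Lemma zariski_near_dense A0 W (O : set X) :
  zariski_near A0 W -> open O -> O !=set0 -> O `&` W !=set0.
Proof.
move=> [f [[_ pf] f0 fW]] oO [A OA].
have [p hp] := pf A A0.
have p0 : p != 0.
  by apply: contraNneq f0 => p0; rewrite -(segment1 A A0) hp p0 horner0.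
have OU : nbhs (0 : R) (segment A A0 @^-1` O).
  apply: (@segment_continuous A A0 0).
  by rewrite segment0; exact: open_nbhs_nbhs.
have [t Ot pt] := poly_neq0_near p0 OU.
by exists (segment A A0 t); split => //; apply: fW; rewrite hp.
Qed.

(* The local ring at [A0] of the affine space [X]. *)
Definition regular_at (A0 : X) (g : X -> R) : Prop :=
  exists n d, [/\ polyfun n, polyfun d, d A0 != 0 &
    forall A, d A != 0 -> g A = n A / d A].

Lemma regular_polyfun A0 f : polyfun f -> regular_at A0 f.
Proof.
move=> pf; exists f, (fun=> 1); split => //.
- exact: polyfun_cst.
- by move=> A _; rewrite divr1.
Qed.

Lemma regularD A0 f g :
  regular_at A0 f -> regular_at A0 g -> regular_at A0 (fun A => f A + g A).
Proof.
move=> [n [d [pn pd d0 fE]]] [m [e [pm pe e0 gE]]].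
exists (fun A => n A * e A + m A * d A), (fun A => d A * e A); split.
- by apply: polyfunD; exact: polyfunM.
- exact: polyfunM.
- exact: mulf_neq0.
- move=> A; rewrite mulf_eq0 negb_or => /andP [dA eA].
  by rewrite fE // gE // addf_div.
Qed.

Lemma regularM A0 f g :
  regular_at A0 f -> regular_at A0 g -> regular_at A0 (fun A => f A * g A).
Proof.
move=> [n [d [pn pd d0 fE]]] [m [e [pm pe e0 gE]]].
exists (fun A => n A * m A), (fun A => d A * e A); split.
- exact: polyfunM.
- exact: polyfunM.
- exact: mulf_neq0.
- move=> A; rewrite mulf_eq0 negb_or => /andP [dA eA].
  by rewrite fE // gE // mulf_div.
Qed.

Lemma regularN A0 f : regular_at A0 f -> regular_at A0 (fun A => - f A).
Proof.
move=> hf; under eq_fun do rewrite -mulN1r.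
by apply: regularM => //; exact/regular_polyfun/polyfun_cst.
Qed.

Lemma regularB A0 f g :
  regular_at A0 f -> regular_at A0 g -> regular_at A0 (fun A => f A - g A).
Proof. by move=> hf /regularN; exact: regularD. Qed.

Lemma regular_div A0 f g : g A0 != 0 ->
  regular_at A0 f -> regular_at A0 g -> regular_at A0 (fun A => f A / g A).
Proof.
move=> g0 hf [n [d [pn pd d0 gE]]]; apply: regularM => //.
have n0 : n A0 != 0 by apply: contraNneq g0 => n0; rewrite gE // n0 mul0r.
(* The extra factor [d] makes the new denominator vanish wherever the formula [n / d] for [g] might
   fail. *)
exists (fun A => d A * d A), (fun A => n A * d A); split.
- exact: polyfunM.
- exact: polyfunM.
- exact: mulf_neq0.
- move=> A; rewrite mulf_eq0 negb_or => /andP [nA dA].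
  by rewrite gE // invf_div -mulf_div divff // mulr1.
Qed.

Lemma regular_near_neq0 A0 f :
  regular_at A0 f -> f A0 != 0 -> zariski_near A0 [set A | f A != 0].
Proof.
move=> [n [d [pn pd d0 fE]]] f0.
have n0 : n A0 != 0 by apply: contraNneq f0 => n0; rewrite fE // n0 mul0r.
exists (fun A => n A * d A); split; [exact: polyfunM | exact: mulf_neq0 |].
move=> A; rewrite mulf_eq0 negb_or => /andP [nA dA] /=.
by rewrite fE // mulf_neq0 // invr_neq0.
Qed.

End PolyFun.

(** * Rank bounds for 6 x 6 completions over a field *)

Section SixBySix.
Variable F : fieldType.

Definition det3 (a b c d e f g h i : F) : F :=
  a * (e * i - f * h) - b * (d * i - f * g) + c * (d * h - e * g).

Lemma det_mx33 (a : nat -> nat -> F) :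
  \det (\matrix_(i < 3, j < 3) a i j) =
  det3 (a 0 0)%N (a 0 1)%N (a 0 2)%N (a 1 0)%N (a 1 1)%N (a 1 2)%N
       (a 2 0)%N (a 2 1)%N (a 2 2)%N.
Proof.
rewrite (expand_det_row _ 0) !big_ord_recl big_ord0 /cofactor.
rewrite !(expand_det_row _ 0) !big_ord_recl !big_ord0 /cofactor !det_mx11 !mxE.
by rewrite /det3 /= /bump /=; ring.
Qed.

Lemma cramer3 (u1 u2 u3 v1 v2 v3 w1 w2 w3 b1 b2 b3 : F) :
  let D := det3 u1 u2 u3 v1 v2 v3 w1 w2 w3 in
  let p := det3 b1 b2 b3 v1 v2 v3 w1 w2 w3 / D in
  let q := det3 u1 u2 u3 b1 b2 b3 w1 w2 w3 / D in
  let r := det3 u1 u2 u3 v1 v2 v3 b1 b2 b3 / D in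
  D != 0 ->
  [/\ p * u1 + q * v1 + r * w1 = b1, p * u2 + q * v2 + r * w2 = b2
    & p * u3 + q * v3 + r * w3 = b3].
Proof.
move=> D p q r D0; rewrite /p /q /r; move: D0; rewrite /D /det3 => D0.
by split; field.
Qed.

(** A submatrix inherits from [mulmx_base] a factorization with inner dimension [\rank M], so it
    cannot have rank [k]. *)
Lemma det_mxsub_eq0 m n k (f : 'I_k -> 'I_m) (g : 'I_k -> 'I_n)
    (M : 'M[F]_(m, n)) :
  (\rank M < k)%N -> \det (mxsub f g M) = 0.
Proof.
move=> rM; apply/eqP; apply: contraTT rM => d0; rewrite -leqNgt.
rewrite -[X in (X <= _)%N](@mxrank_unit F k (mxsub f g M)); last first.
  by rewrite unitmxE unitfE.
rewrite -{1}(mulmx_base M) mxsub_mul.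
exact: leq_trans (mxrankM_maxl _ _) (rank_leq_col _).
Qed.

(* Entries of 6 x 6 matrices with 1-based indices, as in [G62]. *)
Definition entry (M : 'M[F]_6) (i j : nat) : F := M (inord i.-1) (inord j.-1).

Lemma entryE (M : 'M[F]_6) (i j : 'I_6) : M i j = entry M i.+1 j.+1.
Proof. by rewrite /entry /= !inord_val. Qed.

Lemma minor3_eq0 (M : 'M[F]_6) (i1 i2 i3 j1 j2 j3 : nat) :
  (\rank M < 3)%N -> let m := entry M in
  det3 (m i1 j1) (m i1 j2) (m i1 j3) (m i2 j1) (m i2 j2) (m i2 j3)
       (m i3 j1) (m i3 j2) (m i3 j3) = 0.
Proof.
move=> rM m.
pose f s (k : 'I_3) : 'I_6 := inord (nth 0%N s k).-1.
rewrite -(det_mxsub_eq0 (f [:: i1; i2; i3]) (f [:: j1; j2; j3]) rM).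
rewrite -(det_mx33 (fun i j =>
  m (nth 0%N [:: i1; i2; i3] i) (nth 0%N [:: j1; j2; j3] j))).
by congr (\det _); apply/matrixP => i j; rewrite !mxE.
Qed.

Section Formulas.
Variable a : nat -> nat -> F.

(* If rank M < 3, the minors on rows 123, columns 456; rows 123, columns 156;
   rows 124, columns 156; and rows 124, columns 456 give in turn the entries
   [low_x34], [low_x11], [low_x45], [low_x44] of M; [low_minor] is then the
   minor on rows 345, columns 124. *)
Definition low_d1 := a 1 5 * a 2 6 - a 1 6 * a 2 5.
Definition low_d2 := a 2 5 * a 3 6 - a 2 6 * a 3 5.
Definition low_x34 :=
  (a 3 5 * (a 1 4 * a 2 6 - a 1 6 * a 2 4)
   - a 3 6 * (a 1 4 * a 2 5 - a 1 5 * a 2 4)) / low_d1.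
Definition low_x11 :=
  (a 1 5 * (a 2 1 * a 3 6 - a 2 6 * a 3 1)
   - a 1 6 * (a 2 1 * a 3 5 - a 2 5 * a 3 1)) / low_d2.
Definition low_d3 := a 1 6 * a 2 1 - low_x11 * a 2 6.
Definition low_x45 :=
  (a 1 5 * (a 2 1 * a 4 6 - a 2 6 * a 4 1) + a 1 6 * a 2 5 * a 4 1
   - low_x11 * a 2 5 * a 4 6) / low_d3.
Definition low_x44 :=
  (low_x45 * (a 1 4 * a 2 6 - a 1 6 * a 2 4)
   - a 4 6 * (a 1 4 * a 2 5 - a 1 5 * a 2 4)) / low_d1.
Definition low_minor :=
  det3 (a 3 1) (a 3 2) low_x34 (a 4 1) (a 4 2) low_x44
       (a 5 1) (a 5 2) (a 5 4).

(* The unknowns of the completion with row1 = row3 + up_mu * row6 and, for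
   k = 2, 4, rowk = up_pk * row3 + up_qk * row6 + up_rk * row5, solved by
   Cramer's rule in columns 1, 2, 3 for k = 4 and 1, 4, 6 for k = 2. *)
Definition up_mu := (a 1 5 - a 3 5) / a 6 5.
Definition up_x33 := a 1 3 - up_mu * a 6 3.
Definition up_x34 := a 1 4 - up_mu * a 6 4.
Definition up_x66 := (a 1 6 - a 3 6) / up_mu.
Definition up_d4 :=
  det3 (a 3 1) (a 3 2) up_x33 (a 6 1) (a 6 2) (a 6 3) (a 5 1) (a 5 2) (a 5 3).
Definition up_p4 :=
  det3 (a 4 1) (a 4 2) (a 4 3) (a 6 1) (a 6 2) (a 6 3) (a 5 1) (a 5 2) (a 5 3)
  / up_d4.
Definition up_q4 :=
  det3 (a 3 1) (a 3 2) up_x33 (a 4 1) (a 4 2) (a 4 3) (a 5 1) (a 5 2) (a 5 3)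
  / up_d4.
Definition up_r4 :=
  det3 (a 3 1) (a 3 2) up_x33 (a 6 1) (a 6 2) (a 6 3) (a 4 1) (a 4 2) (a 4 3)
  / up_d4.
Definition up_x56 := (a 4 6 - up_p4 * a 3 6 - up_q4 * up_x66) / up_r4.
Definition up_d2 :=
  det3 (a 3 1) up_x34 (a 3 6) (a 6 1) (a 6 4) up_x66 (a 5 1) (a 5 4) up_x56.
Definition up_p2 :=
  det3 (a 2 1) (a 2 4) (a 2 6) (a 6 1) (a 6 4) up_x66 (a 5 1) (a 5 4) up_x56
  / up_d2.
Definition up_q2 :=
  det3 (a 3 1) up_x34 (a 3 6) (a 2 1) (a 2 4) (a 2 6) (a 5 1) (a 5 4) up_x56
  / up_d2.
Definition up_r2 :=
  det3 (a 3 1) up_x34 (a 3 6) (a 6 1) (a 6 4) up_x66 (a 2 1) (a 2 4) (a 2 6)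
  / up_d2.
Definition up_x55 := (a 2 5 - up_p2 * a 3 5 - up_q2 * a 6 5) / up_r2.

End Formulas.

Lemma rank_completion_ge3 (S M : 'M[F]_6) :
  let a := entry S in
  low_d1 a != 0 -> low_d2 a != 0 -> low_d3 a != 0 -> low_minor a != 0 ->
  (forall i j : 'I_6, (i.+1, j.+1) \notin G62 -> M i j = S i j) ->
  (3 <= \rank M)%N.
Proof.
move=> a d1 d2 d3 dm MS; rewrite leqNgt; apply: contra dm => rM.
have ma i j : (0 < i <= 6)%N -> (0 < j <= 6)%N -> (i, j) \notin G62 ->
    entry M i j = a i j.
  case: i j => [|i] [|j] //= hi hj hij.
  by apply: MS; rewrite /= !inordK.
have minor := minor3_eq0 _ _ _ _ _ _ rM.
(* Each of these four minors is affine in the one entry still unknown, with coefficient [low_d1],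
   [low_d2], [low_d3], [low_d1] in turn. The [set] shields that entry from [ma]. *)
have x34 : entry M 3 4 = low_x34 a.
  have := minor 1%N 2%N 3%N 4%N 5%N 6%N; rewrite /=; set x := entry M 3 4;
    rewrite !ma // => h.
  apply: (mulIf d1); rewrite /low_x34 divfK //.
  by apply/eqP; rewrite -subr_eq0 -h /det3 /low_d1; apply/eqP; ring.
have x11 : entry M 1 1 = low_x11 a.
  have := minor 1%N 2%N 3%N 1%N 5%N 6%N; rewrite /=; set x := entry M 1 1;
    rewrite !ma // => h.
  apply: (mulIf d2); rewrite /low_x11 divfK //.
  by apply/eqP; rewrite -subr_eq0 -h /det3 /low_d2; apply/eqP; ring.
have x45 : entry M 4 5 = low_x45 a.
  have := minor 1%N 2%N 4%N 1%N 5%N 6%N; rewrite /= x11; set x := entry M 4 5;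
    rewrite !ma // => h.
  apply: (mulIf d3); rewrite /low_x45 divfK //.
  by apply/eqP; rewrite -subr_eq0 -h /det3 /low_d3; apply/eqP; ring.
have x44 : entry M 4 4 = low_x44 a.
  have := minor 1%N 2%N 4%N 4%N 5%N 6%N; rewrite /= x45; set x := entry M 4 4;
    rewrite !ma // => h.
  apply: (mulIf d1); rewrite /low_x44 divfK //.
  by apply/eqP; rewrite -subr_eq0 -h /det3 /low_d1; apply/eqP; ring.
have := minor 3%N 4%N 5%N 1%N 2%N 4%N; rewrite /= x34 x44 !ma // => h.
by rewrite /low_minor h.
Qed.

Lemma exists_completion_rank_le3 (S : 'M[F]_6) :
  let a := entry S in
  a 6 5 != 0 -> up_mu a != 0 -> up_d4 a != 0 -> up_r4 a != 0 ->
  up_d2 a != 0 -> up_r2 a != 0 ->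
  exists2 M : 'M[F]_6, (\rank M <= 3)%N &
    forall i j : 'I_6, (i.+1, j.+1) \notin Gprime62 -> M i j = S i j.
Proof.
move=> a a65 mu0 d4 r4 d2 r2.
have [e41 e42 e43] := cramer3 (a 4 1) (a 4 2) (a 4 3) d4.
have [e21 e24 e26] := cramer3 (a 2 1) (a 2 4) (a 2 6) d2.
(* The rows of [Y] are rows 3, 6, 5 of the completion; row [i] of [X] holds the coefficients of row
   [i] on them. *)
pose X : seq (seq F) := [:: [:: 1; up_mu a; 0]; [:: up_p2 a; up_q2 a; up_r2 a];
  [:: 1; 0; 0]; [:: up_p4 a; up_q4 a; up_r4 a]; [:: 0; 0; 1]; [:: 0; 1; 0]].
pose Y : seq (seq F) :=
  [:: [:: a 3 1; a 3 2; up_x33 a; up_x34 a; a 3 5; a 3 6];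
      [:: a 6 1; a 6 2; a 6 3; a 6 4; a 6 5; up_x66 a];
      [:: a 5 1; a 5 2; a 5 3; a 5 4; up_x55 a; up_x56 a]].
exists ((\matrix_(i < 6, k < 3) nth 0 (nth [::] X i) k) *m
        (\matrix_(k < 3, j < 6) nth 0 (nth [::] Y k) j)).
  exact: leq_trans (mxrankM_maxl _ _) (rank_leq_col _).
move=> i j; rewrite [S i j]entryE -/a mxE !big_ord_recl big_ord0 !mxE.
case: i j => [i hi] [j hj] /=.
move: i j hi hj.
(* With the Cramer equations, these cover all specified entries of rows 1, 2, 4. They hold by the
   choice of [up_x33], [up_x34], [up_mu], [up_x66], [up_x55], [up_x56] in turn. *)
have e13 : up_x33 a + up_mu a * a 6 3 = a 1 3 by rewrite subrK.
have e14 : up_x34 a + up_mu a * a 6 4 = a 1 4 by rewrite subrK.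
have e15 : a 3 5 + up_mu a * a 6 5 = a 1 5 by rewrite divfK // subrKC.
have e16 : a 3 6 + up_mu a * up_x66 a = a 1 6.
  by rewrite [up_mu a * _]mulrC divfK // subrKC.
have e25 : up_p2 a * a 3 5 + up_q2 a * a 6 5 + up_r2 a * up_x55 a = a 2 5.
  by rewrite [up_r2 a * _]mulrC divfK //; ring.
have e46 : up_p4 a * a 3 6 + up_q4 a * up_x66 a + up_r4 a * up_x56 a = a 4 6.
  by rewrite [up_r4 a * _]mulrC divfK //; ring.
do 6?[case=> [|] //]; do 6?[case=> [|] //] => _ _ //= _;
  by rewrite ?mul0r ?addr0 ?add0r ?mul1r ?addrA.
Qed.

End SixBySix.

(** * Reduction to the Schur complement *)

Section Schur.

Variables (F : fieldType) (m k : nat).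

(** The Schur complement of the lower right block, scaled by the determinant of that block so that
    its entries are polynomial in those of [M]. *)
Definition scaled_schur (M : 'M[F]_(m + k)) : 'M[F]_m :=
  \det (drsubmx M) *: ulsubmx M - ursubmx M *m \adj (drsubmx M) *m dlsubmx M.

Lemma scaled_schurE (M : 'M[F]_(m + k)) i j :
  scaled_schur M i j = \det (drsubmx M) * ulsubmx M i j
    - (ursubmx M *m \adj (drsubmx M) *m dlsubmx M) i j.
Proof. by rewrite /scaled_schur !mxE. Qed.

(** Block elimination: up to unipotent factors on both sides, [M] is block diagonal with the Schur
    complement and the invertible lower right block. *)
Lemma rank_scaled_schur (M : 'M[F]_(m + k)) :
  \det (drsubmx M) != 0 -> \rank M = (\rank (scaled_schur M) + k)%N.
Proof.
rewrite /scaled_schur -{2}(submxK M).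
move: (ulsubmx M) (ursubmx M) (dlsubmx M) (drsubmx M) => P Q R D d0.
have uD : D \in unitmx by rewrite unitmxE unitfE.
pose T := P - Q *m invmx D *m R.
have -> : \det D *: P - Q *m \adj D *m R = \det D *: T.
  rewrite /T scalerBr /invmx uD -scalemxAr -scalemxAl scalerA.
  by rewrite divff // scale1r.
rewrite (eqmx_scale T d0).
have -> : block_mx P Q R D = block_mx 1%:M (Q *m invmx D) 0 1%:M
    *m block_mx T 0 0 D *m block_mx 1%:M 0 (invmx D *m R) 1%:M.
  rewrite !mulmx_block !(mul1mx, mul0mx, mulmx1, mulmx0, addr0, add0r).
  by rewrite mulmxKV // mulKVmx // mulmxA /T subrK.
rewrite mxrankMfree; last first.
  by rewrite row_free_unit unitmxE det_lblock !det1 mulr1 unitr1.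
rewrite eqmxMfull; last first.
  by rewrite row_full_unit unitmxE det_ublock !det1 mulr1 unitr1.
by rewrite rank_diag_block_mx (mxrank_unit uD).
Qed.

End Schur.

(** * Both rank bounds hold on a Zariski neighbourhood *)

Section Generic.
Variables (R : realType) (I : eqType).
Local Notation X := (prod_topology (fun _ : I => R : topologicalType)).

(* At this point all the denominators in [low_minor], [up_r4] and [up_r2] are
   1 or -1. *)
Definition base_seq : seq (seq R) :=
  [:: [:: 0; 0; -1; 0; 1; -1]; [:: -1; 0; 0; 1; 1; 0]; [:: 0; 0; 0; 0; 0; -1];
      [:: -1; 0; 0; 0; 0; 0]; [:: 0; -1; 1; 1; 0; 0]; [:: -1; 1; 0; 0; 1; 0]].

Definition base_point : 'M[R]_6 :=
  \matrix_(i < 6, j < 6) nth 0 (nth [::] base_seq i) j.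

Lemma base_entry i j : (0 < i <= 6)%N -> (0 < j <= 6)%N ->
  entry base_point i j = nth 0 (nth [::] base_seq i.-1) j.-1.
Proof. by case: i j => [|i] [|j] // hi hj; rewrite /entry mxE !inordK. Qed.

Variables (A0 : X) (S : X -> 'M[R]_6).
Hypothesis S_poly : forall i j, polyfun (fun A => S A i j).
Hypothesis S0 : S A0 = base_point.

Let a A := entry (S A).

Let reg_a i j : regular_at A0 (fun A => a A i j).
Proof. exact/regular_polyfun/S_poly. Qed.

Let a0E i j : (0 < i <= 6)%N -> (0 < j <= 6)%N ->
  a A0 i j = nth 0 (nth [::] base_seq i.-1) j.-1.
Proof. by move=> hi hj; rewrite /a S0 base_entry. Qed.

Local Ltac value := rewrite ?a0E //= ?invrN ?invr1; ring.
Local Ltac regular := repeat first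
  [ apply: reg_a | assumption | apply: regularB | apply: regularD
  | apply: regularM ].

(** [S] stands for the scaled Schur complement of a filling, which is polynomial in the filling. *)
Lemma near_rank_completion_ge3 :
  zariski_near A0 [set A | forall M : 'M[R]_6,
    (forall i j : 'I_6, (i.+1, j.+1) \notin G62 -> M i j = S A i j) ->
    (3 <= \rank M)%N].
Proof.
(* A quotient is shown regular only once its denominator is known to be nonzero at [A0]; hence the
   interleaving of values ([v]), regularity ([r]) and nonvanishing ([n]). *)
have vd1 : low_d1 (a A0) = 1 by rewrite /low_d1; value.
have vd2 : low_d2 (a A0) = -1 by rewrite /low_d2; value.
have rd1 : regular_at A0 (fun A => low_d1 (a A)) by rewrite /low_d1; regular.
have rd2 : regular_at A0 (fun A => low_d2 (a A)) by rewrite /low_d2; regular.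
have nd1 : low_d1 (a A0) != 0 by rewrite vd1 oner_neq0.
have nd2 : low_d2 (a A0) != 0 by rewrite vd2 oppr_eq0 oner_neq0.
have v34 : low_x34 (a A0) = -1 by rewrite /low_x34 vd1; value.
have r34 : regular_at A0 (fun A => low_x34 (a A)).
  by rewrite /low_x34; apply: regular_div => //; regular.
have v11 : low_x11 (a A0) = -1 by rewrite /low_x11 vd2; value.
have r11 : regular_at A0 (fun A => low_x11 (a A)).
  by rewrite /low_x11; apply: regular_div => //; regular.
have vd3 : low_d3 (a A0) = 1 by rewrite /low_d3 v11; value.
have rd3 : regular_at A0 (fun A => low_d3 (a A)) by rewrite /low_d3; regular.
have nd3 : low_d3 (a A0) != 0 by rewrite vd3 oner_neq0.
have v45 : low_x45 (a A0) = 1 by rewrite /low_x45 v11 vd3; value.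
have r45 : regular_at A0 (fun A => low_x45 (a A)).
  by rewrite /low_x45; apply: regular_div => //; regular.
have v44 : low_x44 (a A0) = 1 by rewrite /low_x44 v45 vd1; value.
have r44 : regular_at A0 (fun A => low_x44 (a A)).
  by rewrite /low_x44; apply: regular_div => //; regular.
have vm : low_minor (a A0) = -1 by rewrite /low_minor /det3 v34 v44; value.
have rm : regular_at A0 (fun A => low_minor (a A)).
  by rewrite /low_minor /det3; regular.
have nm : low_minor (a A0) != 0 by rewrite vm oppr_eq0 oner_neq0.
have near_d1 := regular_near_neq0 rd1 nd1.
have near_d2 := regular_near_neq0 rd2 nd2.
have near_d3 := regular_near_neq0 rd3 nd3.
have near_m := regular_near_neq0 rm nm.
apply: zariski_nearS (zariski_nearI (zariski_nearI near_d1 near_d2)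
  (zariski_nearI near_d3 near_m)) => A [[d1 d2] [d3 dm]] M MS.
exact: rank_completion_ge3 MS.
Qed.

Lemma near_exists_completion_rank_le3 :
  zariski_near A0 [set A | exists2 M : 'M[R]_6, (\rank M <= 3)%N &
    forall i j : 'I_6, (i.+1, j.+1) \notin Gprime62 -> M i j = S A i j].
Proof.
have n65 : a A0 6 5 != 0 by rewrite a0E //= oner_neq0.
have vmu : up_mu (a A0) = 1 by rewrite /up_mu; value.
have rmu : regular_at A0 (fun A => up_mu (a A)).
  by rewrite /up_mu; apply: regular_div => //; regular.
have nmu : up_mu (a A0) != 0 by rewrite vmu oner_neq0.
have v33 : up_x33 (a A0) = -1 by rewrite /up_x33 vmu; value.
have r33 : regular_at A0 (fun A => up_x33 (a A)) by rewrite /up_x33; regular.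
have v34 : up_x34 (a A0) = 0 by rewrite /up_x34 vmu; value.
have r34 : regular_at A0 (fun A => up_x34 (a A)) by rewrite /up_x34; regular.
have v66 : up_x66 (a A0) = 0 by rewrite /up_x66 vmu; value.
have r66 : regular_at A0 (fun A => up_x66 (a A)).
  by rewrite /up_x66; apply: regular_div => //; regular.
have vd4 : up_d4 (a A0) = -1 by rewrite /up_d4 /det3 v33; value.
have rd4 : regular_at A0 (fun A => up_d4 (a A)).
  by rewrite /up_d4 /det3; regular.
have nd4 : up_d4 (a A0) != 0 by rewrite vd4 oppr_eq0 oner_neq0.
have vp4 : up_p4 (a A0) = 1 by rewrite /up_p4 /det3 vd4; value.
have rp4 : regular_at A0 (fun A => up_p4 (a A)).
  by rewrite /up_p4 /det3; apply: regular_div => //; regular.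
have vq4 : up_q4 (a A0) = 1 by rewrite /up_q4 /det3 vd4 v33; value.
have rq4 : regular_at A0 (fun A => up_q4 (a A)).
  by rewrite /up_q4 /det3; apply: regular_div => //; regular.
have vr4 : up_r4 (a A0) = 1 by rewrite /up_r4 /det3 vd4 v33; value.
have rr4 : regular_at A0 (fun A => up_r4 (a A)).
  by rewrite /up_r4 /det3; apply: regular_div => //; regular.
have nr4 : up_r4 (a A0) != 0 by rewrite vr4 oner_neq0.
have v56 : up_x56 (a A0) = 1 by rewrite /up_x56 vp4 vq4 v66 vr4; value.
have r56 : regular_at A0 (fun A => up_x56 (a A)).
  by rewrite /up_x56; apply: regular_div => //; regular.
have vd2 : up_d2 (a A0) = 1 by rewrite /up_d2 /det3 v34 v66 v56; value.
have rd2 : regular_at A0 (fun A => up_d2 (a A)).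
  by rewrite /up_d2 /det3; regular.
have nd2 : up_d2 (a A0) != 0 by rewrite vd2 oner_neq0.
have vr2 : up_r2 (a A0) = 1 by rewrite /up_r2 /det3 vd2 v34 v66; value.
have rr2 : regular_at A0 (fun A => up_r2 (a A)).
  by rewrite /up_r2 /det3; apply: regular_div => //; regular.
have nr2 : up_r2 (a A0) != 0 by rewrite vr2 oner_neq0.
have near65 := regular_near_neq0 (reg_a 6 5) n65.
have near_mu := regular_near_neq0 rmu nmu.
have near_d4 := regular_near_neq0 rd4 nd4.
have near_r4 := regular_near_neq0 rr4 nr4.
have near_d2 := regular_near_neq0 rd2 nd2.
have near_r2 := regular_near_neq0 rr2 nr2.
apply: zariski_nearS (zariski_nearI (zariski_nearI near65 near_mu)
  (zariski_nearI (zariski_nearI near_d4 near_r4)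
    (zariski_nearI near_d2 near_r2))).
by move=> A [[? ?] [[? ?] [? ?]]]; exact: exists_completion_rank_le3.
Qed.

End Generic.

(** * Generic minimal completion rank for [N = 6 + k] *)

Section Completion.
Variables (R : realType) (k : nat) (U : seq (nat * nat)).
Hypothesis sub_U : {subset Gprime62 <= U}.
Hypothesis U_sub : {subset U <= G62}.

Let Sp := complement_pattern (6 + k) U.
Local Notation X := (partial_filling R Sp).

(** Its lower right block has determinant 1 and its scaled Schur complement is [base_point]. *)
Let B0 : 'M[R]_(6 + k) := block_mx (base_point R) 0 0 1%:M.

(* Any constants would do at the unspecified entries; those of [B0] make
   [fill_base] true. *)
Definition fill (A : X) : 'M[R]_(6 + k) :=
  \matrix_(i, j) if insub (i, j) is Some p then A p else B0 i j.

Let A0 : X := fun p => B0 (val p).1 (val p).2.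

Lemma fill_base : fill A0 = B0.
Proof.
apply/matrixP => i j; rewrite mxE; case: insubP => //= p _ ep.
by rewrite -[RHS]/(B0 (i, j).1 (i, j).2) -ep.
Qed.

Lemma polyfun_fill i j : polyfun (fun A : X => fill A i j).
Proof.
apply: (@eq_polyfun _ _ (fun A : X =>
  if insub (i, j) is Some p then A p else B0 i j)) => [A|].
  by rewrite mxE.
by case: (insub (i, j)) => [p|]; [exact: polyfun_coord | exact: polyfun_cst].
Qed.

Lemma completionP (A : X) (M : 'M[R]_(6 + k)) : is_completion A M <->
  forall i j, (i, j) \in Sp -> M i j = fill A i j.
Proof.
split=> [hM i j hij | hM p].
  by rewrite mxE insubT; exact: (hM (Sub (i, j) hij)).
rewrite hM -?surjective_pairing ?(valP p) // mxE -surjective_pairing.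
by rewrite valK.
Qed.

Lemma large_unspecified i j : (6 < maxn i j)%N -> (i, j) \notin U.
Proof.
move=> hij; apply/negP => /U_sub.
have : all (fun p => maxn p.1 p.2 <= 6)%N G62 by [].
by move=> /allP h /h /=; rewrite leqNgt hij.
Qed.

(** The 1-based index of [rshift 6 j] is [7 + j], outside the 6 x 6 corner that contains [U]. *)
Lemma specified_ur i j : (lshift k i, rshift 6 j) \in Sp.
Proof. by rewrite inE large_unspecified // leq_max (leq_addr j 7) orbT. Qed.

Lemma specified_dl i j : (rshift 6 i, lshift k j) \in Sp.
Proof. by rewrite inE large_unspecified // leq_max (leq_addr i 7). Qed.

Lemma specified_dr i j : (rshift 6 i, rshift 6 j) \in Sp.
Proof. by rewrite inE large_unspecified // leq_max (leq_addr i 7). Qed.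

(** Completions differ only in the upper left block, so they all share the correction term of the
    Schur complement. *)
Lemma completion_block (A : X) (M : 'M[R]_(6 + k)) : is_completion A M <->
  [/\ ursubmx M = ursubmx (fill A), dlsubmx M = dlsubmx (fill A),
      drsubmx M = drsubmx (fill A) &
      forall i j : 'I_6, (i.+1, j.+1) \notin U ->
        ulsubmx M i j = ulsubmx (fill A) i j].
Proof.
split=> [/completionP hM | [hur hdl hdr hul]].
  split; [apply/matrixP => i j | apply/matrixP => i j | apply/matrixP => i j |
    move=> i j hij]; rewrite [LHS]mxE [LHS]mxE [RHS]mxE [RHS]mxE hM //.
  - exact: specified_ur.
  - exact: specified_dl.
  - exact: specified_dr.
  - by rewrite inE.
apply/completionP => i j; rewrite -(submxK M) -(submxK (fill A)) hur hdl hdr.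
case: (split_ordP i) => i' ->; case: (split_ordP j) => j' ->;
  rewrite ?(block_mxEul, block_mxEur, block_mxEdl, block_mxEdr) //.
by rewrite inE => /hul.
Qed.

(** The lower bound for [G62], which leaves the most freedom, and the completion for [Gprime62],
    which leaves the least, together settle every [U] in between. *)
Lemma near_min_completion_rank :
  zariski_near A0 [set A | is_min_completion_rank A (3 + k)].
Proof.
pose S (A : X) := scaled_schur (fill A).
have ul_poly i j : polyfun (fun A : X => ulsubmx (fill A) i j).
  apply: eq_polyfun (polyfun_fill (lshift k i) (lshift k j)) => A.
  by rewrite [LHS]mxE mxE.
have ur_poly i j : polyfun (fun A : X => ursubmx (fill A) i j).
  apply: eq_polyfun (polyfun_fill (lshift k i) (rshift 6 j)) => A.
  by rewrite [LHS]mxE mxE.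
have dl_poly i j : polyfun (fun A : X => dlsubmx (fill A) i j).
  apply: eq_polyfun (polyfun_fill (rshift 6 i) (lshift k j)) => A.
  by rewrite [LHS]mxE mxE.
have dr_poly i j : polyfun (fun A : X => drsubmx (fill A) i j).
  apply: eq_polyfun (polyfun_fill (rshift 6 i) (rshift 6 j)) => A.
  by rewrite [LHS]mxE mxE.
have det_poly : polyfun (fun A : X => \det (drsubmx (fill A))).
  exact: polyfun_det.
have S_poly i j : polyfun (fun A => S A i j).
  have -> : (fun A => S A i j) = fun A =>
      \det (drsubmx (fill A)) * ulsubmx (fill A) i j
      + -1 * (ursubmx (fill A) *m \adj (drsubmx (fill A))
              *m dlsubmx (fill A)) i j.
    by apply/funext => A; rewrite mulN1r; exact: scaled_schurE.
  apply: polyfunD; apply: polyfunM => //; first exact: polyfun_cst.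
  apply: polyfun_mulmx => // *; apply: polyfun_mulmx => // *.
  exact: polyfun_adj.
have S0 : S A0 = base_point R.
  rewrite /S fill_base /scaled_schur /B0.
  rewrite block_mxKul block_mxKur block_mxKdl block_mxKdr.
  by rewrite det1 scale1r !mul0mx subr0.
have det0 : \det (drsubmx (fill A0)) != 0.
  by rewrite fill_base /B0 block_mxKdr det1 oner_neq0.
have near_det := regular_near_neq0 (regular_polyfun _ det_poly) det0.
apply: zariski_nearS (zariski_nearI near_det (zariski_nearI
  (near_rank_completion_ge3 S_poly S0)
  (near_exists_completion_rank_le3 S_poly S0))).
move=> A [/= d0 [ge3 [Z rZ ZS]]].
have rank_ge M : is_completion A M -> (3 + k <= \rank M)%N.
  move=> /completion_block [hur hdl hdr hul].
  rewrite rank_scaled_schur ?hdr // leq_add2r; apply: ge3 => i j hij.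
  rewrite /S !scaled_schurE hur hdl hdr hul //.
  by apply: contra hij; exact: U_sub.
split=> //.
(* The upper left block is solved from the requirement that the scaled Schur complement of [M] be
   [Z]. *)
pose M : 'M[R]_(6 + k) := block_mx
  ((\det (drsubmx (fill A)))^-1 *: (Z + ursubmx (fill A)
     *m \adj (drsubmx (fill A)) *m dlsubmx (fill A)))
  (ursubmx (fill A)) (dlsubmx (fill A)) (drsubmx (fill A)).
have cM : is_completion A M.
  apply/completion_block.
  rewrite block_mxKul block_mxKur block_mxKdl block_mxKdr.
  split=> // i j hij; rewrite mxE [X in _ * X]mxE ZS; last first.
    by apply: contra hij; exact: sub_U.
  by rewrite /S scaled_schurE subrK mulKf.
exists M => //; apply/eqP; rewrite eqn_leq rank_ge // andbT.
rewrite rank_scaled_schur ?block_mxKdr // leq_add2r.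
rewrite /scaled_schur block_mxKul block_mxKur block_mxKdl block_mxKdr.
by rewrite scalerA divff // scale1r addrK.
Qed.

(** An open set witnessing a typical rank [r] meets the dense locus where the minimum is [3 + k],
    and minima are unique; conversely that locus contains a nonempty open set. *)
Lemma typical_coranks_eq3 : typical_coranks R Sp = [set 3%N].
Proof.
apply/seteqP; split=> [_ [r [V [oV V0 Vr]] <-] | _ ->].
  have [A [VA [[M cM rM] min]]] :=
    zariski_near_dense near_min_completion_rank oV V0.
  have [[M' cM' rM'] min'] := Vr A VA.
  have -> : r = (3 + k)%N.
    by apply/eqP; rewrite eqn_leq -{1}rM min' //= -rM' min.
  by rewrite subnDr.
exists (3 + k)%N; last by rewrite subnDr.
have [V [oV V0 VW]] := zariski_near_open near_min_completion_rank.
by exists V; split.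
Qed.

End Completion.

Theorem proposition4p5 (R : realType) (U : seq (nat * nat))
    (hU : U = G62 \/ U = Gprime62) (N : nat) (hN : (6 <= N)%N) :
  typical_coranks R (complement_pattern N U) = [set 3%N]%classic.
Proof.
rewrite -(subnKC hN); apply: typical_coranks_eq3 => p.
  by case: hU => -> // hp; rewrite mem_cat hp.
by case: hU => -> // hp; rewrite mem_cat hp.
Qed.
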